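(* Let $t\ge 0$, $N=16\cdot 2^t$, and let $X$ be the maximal regular design of resolution IV with $N$ runs and $5N/16$ factors (constructed by doubling as in the context). Let $D$ and $\overline{D}$ be a pair of complementary projection designs of $X$, with $n$ and $u=5N/16-n$ columns respectively. Suppose $25N/128\le n\le 5N/16$. Then $D$ has minimum aberration among all possible $n$-factor projections of $X$ if the following two conditions hold: (i) $A_4(\overline{D}),-A_5(\overline{D}),A_6(\overline{D}),-A_7(\overline{D}),\ldots$ are sequentially minimized among all $u$-factor projection designs of $X$; (ii) $|f_i-f_j|\le 1$ for all $1\le i<j\le 5$, where $f_i$ is the number of columns of $\overline{D}$ generated from the $i$th column of $X_0$.
   Context: Two-level regular design: a matrix with entries $0,1$ having $N=2^k$ rows (runs) and $n$ columns (factors) whose rows, up to order, are $(\langle a_1,x\rangle,\dots,\langle a_n,x\rangle)$, $x\in\mathbb{F}_2^k$, for some $a_1,\dots,a_n\in\mathbb{F}_2^k$. A defining word of length $i\ge1$ is a set of $i$ columns whose sum is the zero vector mod 2. $A_i(D)$ is the number of defining words of length $i$ of $D$ ($A_i(D)=0$ if $i$ exceeds the number of columns). A design has minimum aberration within a class of designs with the same numbers of runs and factors if it sequentially minimizes $A_1,A_2,\dots,A_n$ over the class, i.e. its vector $(A_1,\dots,A_n)$ is lexicographically smallest. In general, ''sequentially minimized'' means that the vector is lexicographically smallest. Doubling: the double of a $0/1$ matrix $Y$ is $\begin{pmatrix} Y & Y \\ Y & Y+1 \end{pmatrix}$ (mod 2). Each doubling replaces a column $c$ by the two columns $\binom{c}{c}$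 and $\binom{c}{c+1}$; after $t$ doublings of $X_0$, each column of $X_0$ generates $2^t$ columns. $X_0$ is the $16\times5$ regular design defined by $I=ABCDE$: its rows are the 16 vectors of $\mathbb{F}_2^5$ of even weight. $X$ is obtained by doubling $X_0$ $t$ times; it has $N=16\cdot2^t$ rows and $5\cdot2^t=5N/16$ columns. An $n$-factor projection (design) of $X$ is the submatrix of $X$ formed by $n$ of its columns (all rows retained). Complementary projection designs $D,\overline{D}$ of $X$ are formed by a subset of the columns and by the complementary subset. *)

(* Defs.v *)
From HB Require Import structures.
From mathcomp Require Import all_boot all_order all_algebra.

Set Implicit Arguments.
Unset Strict Implicit.
Unset Printing Implicit Defensive.

Import Order.TTheory GRing.Theory Num.Theory.
Local Open Scope ring_scope.

(* A two-level design with N runs and n factors is a matrix 'M['F_2]_(N, n). *)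

Definition num_words N n (D : 'M['F_2]_(N, n)) (i : nat) : nat :=
  #|[set W : {set 'I_n} | (#|W| == i) && (\sum_(j in W) col j D == 0)]|.

(* (A_1, ..., A_n) *)
Definition wordlength_pattern N n (D : 'M['F_2]_(N, n)) : seq nat :=
  [seq num_words D i | i <- index_iota 1 n.+1].

(* (A_4, -A_5, A_6, ..., (-1)^n A_n); the words of length > n that are left
   out contribute only zeros. *)
Definition alternating_pattern N n (D : 'M['F_2]_(N, n)) : seq int :=
  [seq (-1) ^+ i * (num_words D i)%:Z | i <- index_iota 4 n.+1].

(* seqlexi is the lexicographic order; the sequences compared below all have
   the same length, so its convention on proper prefixes plays no role. *)
Definition sequentially_minimizes (T : Type) (d : Order.disp_t)
    (L : orderType d) (C : T -> Prop) (v : T -> seq L) (x : T) : Prop :=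
  C x /\ forall y, C y -> (v x <= v y :> seqlexi L)%O.

Definition minimum_aberration N n (C : 'M['F_2]_(N, n) -> Prop) :
    'M['F_2]_(N, n) -> Prop :=
  sequentially_minimizes C (@wordlength_pattern N n).

Definition projection N m (X : 'M['F_2]_(N, m)) (S : {set 'I_m}) :
    'M['F_2]_(N, #|S|) :=
  colsub (fun k : 'I_#|S| => enum_val k) X.

(* n distinct columns of X, in any order. *)
Definition is_projection N m (X : 'M['F_2]_(N, m)) n (D : 'M['F_2]_(N, n)) :
    Prop :=
  exists2 f : 'I_n -> 'I_m, injective f & D = colsub f X.

Lemma projectionP N m (X : 'M['F_2]_(N, m)) (S : {set 'I_m}) :
  is_projection X (projection X S).
Proof. by exists (fun k => enum_val k) => //; apply: enum_val_inj. Qed.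

Definition double_mx N n (Y : 'M['F_2]_(N, n)) : 'M['F_2]_(N + N, n + n) :=
  block_mx Y Y Y (Y + const_mx 1).

(* m * 2 ^ t, in the form produced by iterating double_mx. *)
Fixpoint dbl_dim (t m : nat) : nat :=
  if t is t'.+1 then (dbl_dim t' m + dbl_dim t' m)%N else m.

Lemma dbl_dimE t m : dbl_dim t m = (m * 2 ^ t)%N.
Proof. by elim: t => [|t IH] /=; rewrite ?muln1 // IH expnS mulnCA mul2n addnn. Qed.

Fixpoint doubling (t N n : nat) (Y : 'M['F_2]_(N, n)) :
    'M['F_2]_(dbl_dim t N, dbl_dim t n) :=
  if t is t'.+1 then double_mx (doubling t' Y) else Y.

(* The column of the initial design from which a column of its t-fold double
   is generated. *)
Fixpoint source (t n : nat) : 'I_(dbl_dim t n) -> 'I_n :=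
  if t is t'.+1 then
    fun j => match split j with inl j' => source j' | inr j' => source j' end
  else id.

Definition even_words : {set 'rV['F_2]_5} :=
  [set v : 'rV['F_2]_5 | ~~ odd #|[set j | v 0 j != 0]|].

Lemma F2_sum_weight n (v : 'rV['F_2]_n) :
  \sum_j v 0 j = #|[set j | v 0 j != 0]|%:R.
Proof.
rewrite -sum1_card natr_sum big_mkcond [RHS]big_mkcond /=; apply: eq_bigr => j _.
by rewrite inE; case: (v 0 j) => [[|[|//]] ?] //=; apply/val_inj.
Qed.

Lemma F2_natr_eq0 n : (n%:R == 0 :> 'F_2) = ~~ odd n.
Proof. by rewrite -val_eqE /= val_Fp_nat // modn2 eqb0. Qed.

Lemma even_wordsE v : (v \in even_words) = (\sum_j v 0 j == 0).
Proof. by rewrite inE F2_sum_weight F2_natr_eq0. Qed.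

Lemma card_even_words : #|even_words| = 16.
Proof.
pose g (w : 'rV['F_2]_4) : 'rV['F_2]_(4 + 1) :=
  row_mx w (const_mx (- \sum_j w 0 j)).
have g_inj : injective g by move=> w w' /eq_row_mx [].
have g_sum w : \sum_j g w 0 j = 0.
  rewrite big_split_ord /= big_ord1 row_mxEr mxE.
  by under eq_bigr do rewrite row_mxEl; rewrite subrr.
have -> : even_words = g @: setT.
  apply/setP => v; rewrite even_wordsE; apply/idP/imsetP => [|[w _ ->]]; last first.
    exact/eqP/g_sum.
  have gP (w : 'rV['F_2]_(4 + 1)) : \sum_j w 0 j = 0 -> w = g (lsubmx w).
    move/eqP; rewrite big_split_ord /= big_ord1 addrC addr_eq0 => /eqP w0.
    rewrite -[LHS]hsubmxK; congr (row_mx _ _); apply/rowP => k.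
    by rewrite !mxE ord1 w0; under [in RHS]eq_bigr do rewrite mxE.
  by move/eqP/gP => v_g; exists (@lsubmx _ 1 4 1 v).
by rewrite card_imset // cardsT card_mx card_Fp.
Qed.

Definition X0 : 'M['F_2]_(16, 5) :=
  \matrix_(i < 16) enum_val (cast_ord (esym card_even_words) i).

Definition X (t : nat) : 'M['F_2]_(dbl_dim t 16, dbl_dim t 5) :=
  doubling t X0.

(* The number of columns in S generated from the i-th column of X0. *)
Definition freq (t : nat) (S : {set 'I_(dbl_dim t 5)}) (i : 'I_5) : nat :=
  #|[set j in S | source j == i]|.

(* Main.v *)
Require Import Defs.
From mathcomp Require Import all_boot all_order all_algebra.
From mathcomp Require Import zify ring.

(* Summing prod_{j in S} (1 + (-1)^{X_kj} x) over the rows k of X gives N times the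
   word enumerator W_S(x) (MacWilliams). A row of X is either one of 16 rows that
   repeat a row of X0, or contains as many zeros as ones; in the second case the
   product over D equals (1 - x^2)^(5N/32 - u) times the product over the complement
   at -x. Hence W_D(x) = (1 - x^2)^(5N/32 - u) W_{Dbar}(-x) + H, where H depends only
   on the multiset of frequencies f_1, ..., f_5.
   With T = N/16, the x^4-coefficient of H is, up to a positive factor and a constant,
   4 sum f_i^3 + (9T - 6u) sum f_i^2, and for 8u <= 15T its minimizers are exactly the
   balanced frequency vectors. A projection with unbalanced frequencies therefore loses
   strictly at A_4. Balanced vectors of the same sum are permutations of each other, so
   that H cancels, and multiplication by (1 - x^2)^(5N/32 - u), whose constant term
   is 1, preserves the lexicographic order. *)

Set Implicit Arguments.
Unset Strict Implicit.
Unset Printing Implicit Defensive.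

Import Order.TTheory GRing.Theory Num.Theory.
Local Open Scope ring_scope.

(** * Words inside a set of columns *)

(** Counting inside subsets of the columns of one fixed matrix puts a design, its complement and all
    competitors over the same index type. *)
Definition num_subwords N m (Y : 'M['F_2]_(N, m)) (S : {set 'I_m}) (i : nat) : nat :=
  #|[set W : {set 'I_m} | [&& W \subset S, #|W| == i & \sum_(j in W) col j Y == 0]]|.

Lemma num_words_colsub N m n (Y : 'M['F_2]_(N, m)) (f : 'I_n -> 'I_m) i :
  injective f -> num_words (colsub f Y) i = num_subwords Y [set f j | j : 'I_n] i.
Proof.
move=> f_inj; rewrite /num_words /num_subwords.
rewrite -(card_imset _ (imset_inj f_inj)); apply: eq_card => W.
have sumE (V : {set 'I_n}) :
    \sum_(j in f @: V) col j Y = \sum_(j in V) col j (colsub f Y).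
  rewrite big_imset /=; last by move=> ? ? _ _ /f_inj.
  by apply: eq_bigr => j _; apply/colP => k; rewrite !mxE.
rewrite inE; apply/imsetP/idP => [[V]|/and3P[sWf /eqP cW sum0]].
  rewrite inE => /andP[/eqP cV sum0] ->.
  rewrite (card_imset _ f_inj) cV eqxx sumE sum0 !andbT.
  by apply/subsetP => _ /imsetP[j _ ->]; rewrite imset_f.
have defW : f @: (f @^-1: W) = W.
  apply/setP => j; apply/imsetP/idP => [[l]|Wj]; first by rewrite inE => ? ->.
  by have /imsetP[l _ jE] := subsetP sWf _ Wj; exists l; rewrite // inE -jE.
exists (f @^-1: W) => //.
by rewrite inE -sumE defW sum0 -(card_imset _ f_inj) defW cW eqxx.
Qed.

Lemma num_subwords0 N m (Y : 'M['F_2]_(N, m)) (S : {set 'I_m}) :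
  num_subwords Y S 0 = 1%N.
Proof.
apply/eqP/cards1P; exists set0; apply/setP => W; rewrite !inE cards_eq0.
by case: eqP => [->|_]; rewrite ?andbF // sub0set big_set0 eqxx.
Qed.

Lemma num_subwords_gt N m (Y : 'M['F_2]_(N, m)) (S : {set 'I_m}) i :
  (#|S| < i)%N -> num_subwords Y S i = 0%N.
Proof.
move=> ltSi; apply/eqP; rewrite cards_eq0; apply/eqP/setP => W; rewrite !inE.
apply/negP => /and3P[/subset_leq_card sWS /eqP cW _].
by rewrite cW leqNgt ltSi in sWS.
Qed.

(** * Character sums and the word enumerator *)

Definition sgF2 (a : 'F_2) : int := (-1) ^+ a.

Lemma F2P (a : 'F_2) : a = 0 \/ a = 1.
Proof. by case: a => [[|[|//]] ?]; [left|right]; apply/val_inj. Qed.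

Lemma sgF2D : {morph sgF2 : a b / a + b >-> a * b}.
Proof. by move=> a b; case: (F2P a) (F2P b) => -> [] ->. Qed.

Lemma sgF2_sum (I : Type) (r : seq I) (P : pred I) (F : I -> 'F_2) :
  sgF2 (\sum_(i <- r | P i) F i) = \prod_(i <- r | P i) sgF2 (F i).
Proof. by apply: (big_morph sgF2 sgF2D). Qed.

Lemma sgF2_eq1 a : (sgF2 a == 1) = (a == 0).
Proof. by case: (F2P a) => ->. Qed.

(** Regularity in the form suited to character sums: translation by any row permutes the rows,
    repetitions included. *)
Definition rows_closed N m (Y : 'M['F_2]_(N, m)) :=
  forall i, exists2 s : 'I_N -> 'I_N, injective s &
    forall k j, Y (s k) j = Y i j + Y k j.

(** Orthogonality of characters: if row [i] has sign product other than 1, translating by that row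
    multiplies the sum by this product, so the sum vanishes. *)
Lemma sum_sgF2_rows N m (Y : 'M['F_2]_(N, m)) (W : {set 'I_m}) :
  rows_closed Y ->
  \sum_k \prod_(j in W) sgF2 (Y k j) =
    if \sum_(j in W) col j Y == 0 then N%:R else 0.
Proof.
move=> clY; have rowE k : \prod_(j in W) sgF2 (Y k j) =
    sgF2 ((\sum_(j in W) col j Y) k 0).
  by rewrite summxE sgF2_sum; apply: eq_bigr => j _; rewrite mxE.
case: ifP => [/eqP s0|/negbT]; last first.
  move/cV0Pn => [i]; rewrite -sgF2_eq1 -rowE => sgi.
  have [s s_inj sE] := clY i; set Z := \sum_k _.
  have: Z = (\prod_(j in W) sgF2 (Y i j)) * Z.
    rewrite {1}/Z (reindex_inj s_inj) /= mulr_sumr; apply: eq_bigr => k _.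
    by rewrite -big_split; apply: eq_bigr => j _; rewrite sE sgF2D.
  move/eqP; rewrite -{1}[Z]mul1r -subr_eq0 -mulrBl mulf_eq0 subr_eq0 eq_sym.
  by rewrite (negPf sgi) => /eqP.
under eq_bigr do rewrite rowE s0 mxE.
by rewrite sumr_const card_ord.
Qed.

(** For [c] equal to 1 or -1 this is the row product at [x] or at [-x]. *)
Definition sign_poly (c : int) N m (Y : 'M['F_2]_(N, m)) (S : {set 'I_m}) k :
    {poly int} := \prod_(j in S) (1 + (c * sgF2 (Y k j)) *: 'X).

Definition word_poly (c : int) N m (Y : 'M['F_2]_(N, m)) (S : {set 'I_m}) :
    {poly int} :=
  \sum_(W : {set 'I_m} | (W \subset S) && (\sum_(j in W) col j Y == 0))
    c ^+ #|W| *: 'X^#|W|.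

Lemma coef_word_poly c N m (Y : 'M['F_2]_(N, m)) (S : {set 'I_m}) i :
  (word_poly c Y S)`_i = c ^+ i * (num_subwords Y S i)%:R.
Proof.
rewrite coef_sum /num_subwords -sum1_card natr_sum mulr_sumr.
rewrite big_mkcond [RHS]big_mkcond /=; apply: eq_bigr => W _.
rewrite inE coefZ coefXn (eq_sym i).
case: (W \subset S) => //=; case: (#|W| =P i) => [->|_] /=; first by rewrite mulr1.
by rewrite mulr0 if_same.
Qed.

Lemma sum_sign_poly c N m (Y : 'M['F_2]_(N, m)) (S : {set 'I_m}) :
  rows_closed Y -> \sum_k sign_poly c Y S k = N%:R *: word_poly c Y S.
Proof.
move=> clY; rewrite /word_poly scaler_sumr.
have expand k : sign_poly c Y S k =
    \sum_(W : {set 'I_m} | W \subset S)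
      (\prod_(j in W) sgF2 (Y k j)) *: (c ^+ #|W| *: 'X^#|W|).
  rewrite /sign_poly big_mkcond /=.
  (* The value 0 outside [S] kills the subsets not contained in [S] when the product is
     distributed. *)
  rewrite (eq_bigr (fun j => (if j \in S then (c * sgF2 (Y k j)) *: 'X else 0) + 1));
    last by move=> j _; case: ifP; rewrite ?add0r // addrC.
  rewrite bigA_distr [RHS]big_mkcond /=; apply: eq_bigr => W _.
  rewrite -big_mkcond /=; case: ifP => [sWS|/negbT/subsetPn[j Wj Sj]]; last first.
    by rewrite (bigD1 j) //= (negPf Sj) mul0r.
  rewrite (eq_bigr (fun j => (sgF2 (Y k j))%:P * (c *: 'X))).
    rewrite big_split /= prodr_const exprZn.
    by rewrite -rmorph_prod mul_polyC.
  by move=> j /(subsetP sWS) ->; rewrite mul_polyC scalerA mulrC.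
under eq_bigr do rewrite expand.
rewrite exchange_big /= big_mkcond [RHS]big_mkcond /=; apply: eq_bigr => W _.
case: (W \subset S) => //=; rewrite -scaler_suml sum_sgF2_rows //.
by case: ifP => // _; rewrite scale0r.
Qed.

(** * Rows and columns of the doubled designs *)

Lemma X0_row i j : X0 i j = (enum_val (cast_ord (esym card_even_words) i)) 0 j.
Proof. by rewrite mxE. Qed.

Lemma even_words_X0 v : v \in even_words -> exists i, forall j, X0 i j = v 0 j.
Proof.
move=> v_even; exists (cast_ord card_even_words (enum_rank_in v_even v)) => j.
by rewrite X0_row cast_ordK enum_rankK_in.
Qed.

(** These even words of weight two (or zero, if [i = j]) are the test rows that separate two columns
    of [X0]. *)
Lemma X0_pair_row i j : exists r, forall l, X0 r l = (l == i)%:R + (l == j)%:R.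
Proof.
have [|r rE] := @even_words_X0 (delta_mx 0 i + delta_mx 0 j).
  rewrite even_wordsE; under eq_bigr do rewrite !mxE /=.
  have sum1 k : \sum_(l < 5) (l == k)%:R = 1 :> 'F_2.
    by rewrite (bigD1 k) //= eqxx big1 ?addr0 // => l /negPf->.
  by rewrite big_split /= !sum1; apply/eqP/val_inj.
by exists r => l; rewrite rE !mxE.
Qed.

Lemma rows_closed_X0 : rows_closed X0.
Proof.
pose w (i : 'I_16) : 'rV['F_2]_5 := enum_val (cast_ord (esym card_even_words) i).
have w_even i : w i \in even_words by apply: enum_valP.
have w_inj : injective w by move=> i j /enum_val_inj/cast_ord_inj.
have wD i k : w i + w k \in even_words.
  rewrite even_wordsE; under eq_bigr do rewrite mxE.
  have := w_even i; have := w_even k; rewrite !even_wordsE big_split /=.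
  by move=> /eqP -> /eqP ->; rewrite addr0.
move=> i; pose s k := cast_ord card_even_words (enum_rank_in (wD i k) (w i + w k)).
have wsE k : w (s k) = w i + w k by rewrite /w cast_ordK enum_rankK_in.
exists s => [k l skl|k j]; first by apply/w_inj/(addrI (w i)); rewrite -!wsE skl.
by rewrite !X0_row -/(w (s k)) wsE mxE.
Qed.

(** Translation by an upper row preserves the two halves of the rows; translation by a lower row
    exchanges them, because [1 + 1 = 0]. *)
Lemma rows_closed_double N m (Y : 'M['F_2]_(N, m)) :
  rows_closed Y -> rows_closed (double_mx Y).
Proof.
move=> clY i.
pose tw (s : 'I_N -> 'I_N) (b : bool) (k : 'I_(N + N)) : 'I_(N + N) :=
  match split k with
  | inl k' => if b then rshift N (s k') else lshift N (s k')
  | inr k' => if b then lshift N (s k') else rshift N (s k')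
  end.
have tw_inj s b : injective s -> injective (tw s b).
  move=> s_inj; rewrite /tw => k l.
  case: (split_ordP k) => k' ->; case: (split_ordP l) => l' ->; case: b;
  by [move/rshift_inj/s_inj->|move/lshift_inj/s_inj->
     |move/eqP; rewrite ?eq_lrshift ?eq_rlshift].
have F2_11 : 1 + 1 = 0 :> 'F_2 by apply/val_inj.
case: (split_ordP i) => i' ->; have [s s_inj sE] := clY i'.
  exists (tw s false) => [|k j]; first exact: tw_inj.
  rewrite /double_mx /tw; case: (split_ordP k) => k' ->;
  case: (split_ordP j) => j' ->;
  by rewrite ?(block_mxEul, block_mxEur, block_mxEdl, block_mxEdr) ?mxE sE ?addrA.
exists (tw s true) => [|k j]; first exact: tw_inj.
rewrite /double_mx /tw; case: (split_ordP k) => k' ->;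
case: (split_ordP j) => j' ->;
rewrite ?(block_mxEul, block_mxEur, block_mxEdl, block_mxEdr) ?mxE sE //.
  by rewrite addrAC.
by rewrite addrACA F2_11 addr0.
Qed.

Lemma rows_closed_X t : rows_closed (X t).
Proof.
elim: t => [|t IH]; first exact: rows_closed_X0.
exact: (@rows_closed_double _ _ (X t)).
Qed.

(* The rows of [X t] indexed by [(r, z)] with [z = 0], where each column repeats
   the column of [X0] that generates it. *)
Fixpoint base_row t : 'I_16 -> 'I_(dbl_dim t 16) :=
  if t is t'.+1 then fun r => lshift _ (base_row t' r) else id.

Lemma base_row_inj t : injective (base_row t).
Proof. by elim: t => [|t IH] //= r s /lshift_inj/IH. Qed.

Lemma X_base_row t r j : X t (base_row t r) j = X0 r (source j).
Proof.
elim: t j => [|t IH] //= j; rewrite /X /= /double_mx.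
by case: (split_ordP j) => j' ->; rewrite ?(block_mxEul, block_mxEur) IH.
Qed.

(** In a lower row the second half is the negative of the first; an upper row repeats a row of the
    previous stage, which is again not a base row. *)
Lemma sum_sgF2_row t k : k \notin codom (base_row t) -> \sum_j sgF2 (X t k j) = 0.
Proof.
elim: t k => [|t IH] k /=; first by move/negP; case; apply: (codom_f id).
rewrite /X /= /double_mx big_split_ord /=; case: (split_ordP k) => k' -> notb.
  under eq_bigr do rewrite block_mxEul; under [X in _ + X]eq_bigr do rewrite block_mxEur.
  rewrite IH ?addr0 //; apply: contraNN notb => /codomP[r ->].
  by apply/codomP; exists r.
under eq_bigr do rewrite block_mxEdl.
under [X in _ + X]eq_bigr do rewrite block_mxEdr !mxE sgF2D mulrN1.
by rewrite sumrN subrr.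
Qed.

Lemma card_source t i : #|[set j : 'I_(dbl_dim t 5) | source j == i]| = (2 ^ t)%N.
Proof.
rewrite -sum1dep_card; elim: t => [|t IH] /=; first by rewrite big_pred1_eq.
rewrite big_split_ord /= expnS mul2n -addnn; congr (_ + _)%N; rewrite -IH;
apply: eq_bigl => j; by rewrite (unsplitK (inl j), unsplitK (inr j)).
Qed.

Lemma freq_setC t (S : {set 'I_(dbl_dim t 5)}) i :
  (freq S i + freq (~: S) i = 2 ^ t)%N.
Proof.
rewrite -(card_source t i) -(cardsID S) /freq; congr (_ + _)%N; apply: eq_card => j;
by rewrite !inE andbC.
Qed.

Lemma sum_freq t (S : {set 'I_(dbl_dim t 5)}) : (\sum_i freq S i = #|S|)%N.
Proof.
rewrite -sum1_card (partition_big (@source t 5) predT) //=.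
by apply: eq_bigr => i _; rewrite sum1dep_card.
Qed.

Lemma X_col_inj t j l : (forall k, X t k j = X t k l) -> j = l.
Proof.
elim: t j l => [|t IH] j l.
  move=> /= eq_jl; apply/eqP/negPn/negP => nejl.
  (* For [i] outside [{j, l}], the row supported on [j] and [i] is 1 at [j] and 0 at [l]. *)
  have /subsetPn[i _] : ~~ ([set: 'I_5] \subset [set j; l]).
    apply/negP => /subset_leq_card; rewrite cardsT card_ord cards2.
    by case: (_ != _).
  rewrite !inE negb_or => /andP[neij neil].
  have [k kE] := X0_pair_row j i; have := eq_jl k; rewrite /X /= !kE eqxx.
  by rewrite (eq_sym j i) (negPf neij) (eq_sym l j) (negPf nejl) (eq_sym l i) (negPf neil).
rewrite /X /= /double_mx; case: (split_ordP j) => j' ->;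
  case: (split_ordP l) => l' -> eq_jl.
- by congr lshift; apply: IH => k; have := eq_jl (lshift _ k); rewrite !block_mxEul.
(* Columns from different halves: the upper rows force the same parent column, and any lower row
   then separates them; [base_row t 0] merely supplies one. *)
- have j'l' : j' = l'.
    by apply: IH => k; have := eq_jl (lshift _ k); rewrite block_mxEul block_mxEur.
  have := eq_jl (rshift _ (base_row t 0)); rewrite block_mxEdl block_mxEdr !mxE j'l'.
  by move/esym/eqP; rewrite -subr_eq0 addrAC subrr add0r.
- have j'l' : j' = l'.
    by apply: IH => k; have := eq_jl (lshift _ k); rewrite block_mxEul block_mxEur.
  have := eq_jl (rshift _ (base_row t 0)); rewrite block_mxEdl block_mxEdr !mxE j'l'.
  by move/eqP; rewrite -subr_eq0 addrAC subrr add0r.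
- by congr rshift; apply: IH => k; have := eq_jl (lshift _ k); rewrite !block_mxEur.
Qed.

(** Resolution IV. A word of length 2 would repeat a column. In a word of odd length at most 3, some
    source [a] occurs an odd number of times and some source [b] never occurs, so the base row
    supported on [a] and [b] sums to 1 over the word. *)
Lemma num_subwords_X_small t (S : {set 'I_(dbl_dim t 5)}) i :
  (0 < i < 4)%N -> num_subwords (X t) S i = 0%N.
Proof.
move=> /andP[i_gt0 i_lt4].
apply/eqP; rewrite cards_eq0; apply/eqP/setP => W; rewrite !inE.
apply/negP => /and3P[_ /eqP cW /eqP sum0].
have row0 k : \sum_(j in W) X t k j = 0.
  transitivity ((\sum_(j in W) col j (X t)) k 0); last by rewrite sum0 mxE.
  by rewrite summxE; apply: eq_bigr => j _; rewrite mxE.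
have [i_odd|i_even] := boolP (odd i); last first.
  have /cards2P[a [b [neab WE]]] : #|W| == 2%N.
    by rewrite cW; case: i i_gt0 i_lt4 i_even {cW} => [|[|[|[|]]]].
  case/negP: (neab); apply/eqP/X_col_inj => k; apply/eqP; rewrite -subr_eq0.
  have := row0 k; rewrite WE big_setU1 ?in_set1 //= big_set1.
  by case: (F2P (X t k a)) (F2P (X t k b)) => -> [] -> /eqP.
have /existsP[a a_odd] : [exists a, odd (freq W a)].
  apply: contraLR i_odd => /existsPn all_even; rewrite -cW -sum_freq -F2_natr_eq0.
  by rewrite natr_sum big1 // => a _; apply/eqP; rewrite F2_natr_eq0.
have /existsP[b /eqP b0] : [exists b, freq W b == 0%N].
  apply: contraLR i_lt4 => /existsPn all_pos; rewrite -cW -sum_freq -leqNgt.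
  apply: (@leq_trans (\sum_(b < 5) 1)); first by rewrite big_const_ord.
  by apply: leq_sum => b _; rewrite lt0n.
have sum_src c : \sum_(j in W) (source j == c)%:R = (freq W c)%:R :> 'F_2.
  by rewrite -natr_sum -big_mkcondr sum1dep_card.
have [r rE] := X0_pair_row a b; have /eqP := row0 (base_row t r).
under eq_bigr do rewrite X_base_row rE.
by rewrite big_split /= !sum_src b0 addr0 F2_natr_eq0 a_odd.
Qed.

(** * Complementation on a balanced row *)

Lemma prod_sgF2_balanced m (a : 'I_m -> 'F_2) :
  \sum_j sgF2 (a j) = 0 ->
  \prod_j (1 + sgF2 (a j) *: 'X) = (1 - 'X^2) ^+ m./2 :> {poly int}.
Proof.
pose P := [set j | a j == 0]; move=> sum0.
have cP : #|P| = #|~: P|.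
  have sgE j : sgF2 (a j) = (j \in P)%:R - (j \in ~: P)%:R.
    by rewrite !inE; case: (F2P (a j)) => ->.
  move/eqP: sum0; under eq_bigr do rewrite sgE.
  rewrite sumrB -!natr_sum -!big_mkcond !sum1dep_card subr_eq0 eqr_nat.
  by rewrite !cardsE => /eqP.
have mE : (#|P|.*2 = m)%N by rewrite -addnn {2}cP cardsC card_ord.
have -> : m./2 = #|P| by rewrite -(doubleK #|P|) [in RHS]mE.
rewrite (bigID (mem P)) /= (eq_bigr (fun=> 1 + 'X)); last first.
  by move=> j; rewrite inE => /eqP ->; rewrite scale1r.
rewrite prodr_const (eq_bigl (mem (~: P))) => [|j]; last by rewrite !inE.
rewrite (eq_bigr (fun=> 1 - 'X)); last first.
  by move=> j; rewrite !inE; case: (F2P (a j)) => -> // _; rewrite scaleN1r.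
by rewrite prodr_const -cP -exprMn; congr (_ ^+ _); ring.
Qed.

Lemma one_subX2_neq0 : 1 - 'X^2 != 0 :> {poly int}.
Proof. by apply/eqP => /(congr1 (fun p : {poly int} => p`_0)); rewrite !coefE. Qed.

Lemma sign_polyM c N m (Y : 'M['F_2]_(N, m)) (S : {set 'I_m}) k :
  sign_poly c Y S k * sign_poly c Y (~: S) k = \prod_j (1 + (c * sgF2 (Y k j)) *: 'X).
Proof.
rewrite [RHS](bigID (mem S)) /=; congr (_ * _).
by apply: eq_bigl => j; rewrite inE.
Qed.

Lemma sign_poly_opp N m (Y : 'M['F_2]_(N, m)) (S : {set 'I_m}) k :
  sign_poly 1 Y S k * sign_poly (-1) Y S k = (1 - 'X^2) ^+ #|S|.
Proof.
rewrite /sign_poly -big_split -prodr_const; apply: eq_bigr => j _ /=.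
by case: (F2P (Y k j)) => ->; rewrite ?(mul1r, mulr1, mulN1r, opprK, scale1r, scaleN1r); ring.
Qed.

(** The products over [S] and [~: S] multiply to [(1 - x^2)^(m/2)], while those over [~: S] at [x]
    and [-x] multiply to [(1 - x^2)^#|~: S|]; this nonzero power is cancelled. *)
Lemma sign_poly_setC N m (Y : 'M['F_2]_(N, m)) (S : {set 'I_m}) k :
  \sum_j sgF2 (Y k j) = 0 -> (#|~: S| <= m./2)%N ->
  sign_poly 1 Y S k = (1 - 'X^2) ^+ (m./2 - #|~: S|) * sign_poly (-1) Y (~: S) k.
Proof.
move=> sum0 le_u; apply: (mulIf (expf_neq0 #|~: S| one_subX2_neq0)).
rewrite -(sign_poly_opp Y (~: S) k) mulrA sign_polyM.
under eq_bigr do rewrite mul1r.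
rewrite prod_sgF2_balanced // [RHS]mulrAC sign_poly_opp -exprD subnK //.
Qed.

(** * The contribution of the base rows *)

(* The even and odd parts of [(1 + 'X) ^+ m]. *)
Fixpoint pow_parts (m : nat) : {poly int} * {poly int} :=
  if m is m'.+1 then
    let: (e, o) := pow_parts m' in (e + 'X * o, o + 'X * e)
  else (1, 0).

Lemma pow_partsE m (c : int) : c ^+ 2 = 1 ->
  (1 + c *: 'X) ^+ m = (pow_parts m).1 + c *: (pow_parts m).2 :> {poly int}.
Proof.
move=> c2; have c2P : (c%:P) ^+ 2 = 1 :> {poly int} by rewrite -polyC_exp c2.
elim: m => [|m IH] /=; first by rewrite scaler0 addr0.
rewrite exprSr IH; case: (pow_parts m) => e o /=; rewrite -!mul_polyC.
by rewrite -['X * o]mul1r -[in RHS]c2P; ring.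
Qed.

(** The defining relation [I = ABCDE]: a test row on [i] and [j] forces a word to contain both or
    neither. *)
Lemma X0_dual (W : {set 'I_5}) :
  (\sum_(j in W) col j X0 == 0) = (W == set0) || (W == setT).
Proof.
apply/idP/orP => [/eqP sum0|[]/eqP->]; last 2 first.
- by rewrite big_set0.
- apply/eqP/colP => r; rewrite summxE mxE.
  under eq_bigr do rewrite mxE; under eq_bigl do rewrite inE.
  apply/eqP; have := enum_valP (cast_ord (esym card_even_words) r).
  by rewrite even_wordsE; under [in X in _ -> X]eq_bigr do rewrite X0_row.
have memW i j : (i \in W) = (j \in W).
  have sum_mem l : \sum_(k in W) (k == l)%:R = (l \in W)%:R :> 'F_2.
    rewrite big_mkcond (bigD1 l) //= eqxx big1 => [|k /negPf->]; last by case: ifP.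
    by rewrite addr0; case: ifP.
  have [r rE] := X0_pair_row i j; have /colP/(_ r) := sum0.
  rewrite summxE mxE; under eq_bigr do rewrite mxE rE.
  by rewrite big_split /= !sum_mem; case: (i \in W); case: (j \in W) => // /eqP.
have [W0|W0] := boolP (ord0 \in W); [right|left]; apply/eqP/setP => j;
by rewrite inE (memW j ord0) // (negPf W0).
Qed.

(** After expansion over subsets, orthogonality leaves only the empty and the full set, giving the
    all-even and the all-odd product. *)
Lemma sum_prod_X0 (e o : 'I_5 -> {poly int}) :
  \sum_r \prod_i (e i + sgF2 (X0 r i) *: o i) =
  16%:R *: (\prod_i e i + \prod_i o i).
Proof.
have expand r : \prod_i (e i + sgF2 (X0 r i) *: o i) =
    \sum_(W : {set 'I_5}) (\prod_(i in W) sgF2 (X0 r i)) *: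
       \prod_i (if i \in W then o i else e i).
  under eq_bigr do rewrite addrC.
  rewrite bigA_distr; apply: eq_bigr => W _.
  rewrite -mul_polyC rmorph_prod [X in _ = X * _]big_mkcond -big_split /=; apply: eq_bigr => i _.
  by case: ifP; rewrite ?mul1r ?mul_polyC.
rewrite (eq_bigr _ (fun r _ => expand r)) exchange_big /=.
under eq_bigr do rewrite -scaler_suml (sum_sgF2_rows _ rows_closed_X0) X0_dual.
rewrite (bigD1 set0) //= (bigD1 setT) /=; last first.
  by apply/eqP => /setP/(_ ord0); rewrite !inE.
rewrite !eqxx orbT [X in _ + (_ + X)]big1 => [|W /andP[/negPf-> /negPf->]]; last by rewrite scale0r.
rewrite addr0.
rewrite -scalerDr; congr (_ *: (_ + _)); apply: eq_bigr => i _; by rewrite inE.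
Qed.

(* The factor [c ^+ 5] of the odd term is [c], since [c] is only ever [1] or [-1]. *)
Definition base_poly (c : int) (g : 'I_5 -> nat) : {poly int} :=
  \prod_i (pow_parts (g i)).1 + c *: \prod_i (pow_parts (g i)).2.

(** On a base row all columns with source [i] share one sign, so the product groups into fifth-fold
    products of powers [(1 + c x)^f_i] or [(1 - c x)^f_i]. *)
Lemma sum_sign_poly_base (c : int) t (S : {set 'I_(dbl_dim t 5)}) : c ^+ 2 = 1 ->
  \sum_r sign_poly c (X t) S (base_row t r) = 16%:R *: base_poly c (freq S).
Proof.
move=> c2; have -> : base_poly c (freq S) =
    \prod_i (pow_parts (freq S i)).1 + \prod_i (c *: (pow_parts (freq S i)).2).
  congr (_ + _); under [RHS]eq_bigr do rewrite -mul_polyC.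
  rewrite big_split /= prodr_const card_ord -polyC_exp mul_polyC.
  by rewrite (exprD c 2 3) (exprD c 2 1) c2 !mul1r.
rewrite -sum_prod_X0; apply: eq_bigr => r _; rewrite /sign_poly.
rewrite (partition_big (@source t 5) predT) //=; apply: eq_bigr => i _.
rewrite (eq_bigr (fun=> 1 + (c * sgF2 (X0 r i)) *: 'X)); last first.
  by move=> j /andP[_ /eqP <-]; rewrite X_base_row.
rewrite (eq_bigl (mem [set j in S | source j == i])) => [|j]; last by rewrite !inE.
rewrite prodr_const -/(freq S i) pow_partsE ?scalerA 1?[sgF2 _ * _]mulrC //.
by rewrite exprMn c2 mul1r; case: (F2P (X0 r i)) => ->.
Qed.

(** The bracket is the share of the rows other than base rows in the enumerator of the complement;
    only those rows are complemented. The common factor 16 of [N = 16 * 2 ^ t] is divided out. *)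
Lemma word_poly_setC t (S : {set 'I_(dbl_dim t 5)}) :
  (#|~: S| <= (5 * 2 ^ t)./2)%N ->
  (2 ^ t)%:R *: word_poly 1 (X t) S =
  (1 - 'X^2) ^+ ((5 * 2 ^ t)./2 - #|~: S|) *
    ((2 ^ t)%:R *: word_poly (-1) (X t) (~: S) - base_poly (-1) (freq (~: S)))
  + base_poly 1 (freq S).
Proof.
rewrite -dbl_dimE => le_u; set K := (_ - _)%N.
have dimE c A : (16%:R : int) *: ((2 ^ t)%:R *: word_poly c (X t) A) =
    \sum_k sign_poly c (X t) A k.
  by rewrite (sum_sign_poly _ _ (@rows_closed_X t)) scalerA -natrM -dbl_dimE.
apply: (@mulfI _ (16%:R : int)%:P); first by rewrite polyC_eq0.
rewrite !mul_polyC scalerDr scalerAr scalerBr !dimE -!sum_sign_poly_base ?sqrrN ?expr1n //.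
have splitE F : \sum_k F k = \sum_r F (base_row t r) +
    \sum_(k | k \notin codom (base_row t)) F k :> {poly int}.
  rewrite (bigID (mem (codom (base_row t)))) /=; congr (_ + _).
  by rewrite -big_uniq ?big_image //; apply/injectiveP/base_row_inj.
rewrite (splitE (sign_poly 1 _ _)) (splitE (sign_poly (-1) _ _)) addrC; congr (_ + _).
rewrite addrAC subrr add0r mulr_sumr; apply: eq_bigr => k notb.
by apply: sign_poly_setC => //; apply: sum_sgF2_row.
Qed.

(** * The coefficient of [x^4] in the base contribution *)

(* [A = 2a] and [L = 24b - 12a^2], for the coefficients [a] of ['X^2] and [b] of
   ['X^4], are both additive under multiplication. *)
Definition even_quartic (p : {poly int}) (A L : int) : Prop :=
  exists a b (R : {poly int}),
    [/\ p = 1 + a%:P * 'X^2 + b%:P * 'X^4 + 'X^6 * R,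
        A = 2%:R * a & L = 24%:R * b - 12%:R * a ^+ 2].

(** Up to the factors 2 and 24, [A] and [L] are the coefficients of [x^2] and [x^4] in [log p],
    which turns products into sums. *)
Lemma even_quarticM p q A L A' L' :
  even_quartic p A L -> even_quartic q A' L' -> even_quartic (p * q) (A + A') (L + L').
Proof.
move=> [a [b [R [-> -> ->]]]] [a' [b' [R' [-> -> ->]]]].
exists (a + a'), (b + b' + a * a').
exists (R * (1 + a'%:P * 'X^2 + b'%:P * 'X^4 + 'X^6 * R') +
        (1 + a%:P * 'X^2 + b%:P * 'X^4) * R' +
        a%:P * b'%:P + b%:P * a'%:P + b%:P * b'%:P * 'X^2).
by split; [rewrite !polyCD polyCM| |]; ring.
Qed.

Lemma even_quartic1 : even_quartic 1 0 0.
Proof. by exists 0, 0, 0; split; rewrite ?polyC0; ring. Qed.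

Lemma even_quartic_prod (I : finType) (p : I -> {poly int}) (A L : I -> int) :
  (forall i, even_quartic (p i) (A i) (L i)) ->
  even_quartic (\prod_i p i) (\sum_i A i) (\sum_i L i).
Proof.
move=> pq; elim/big_rec3: _ => [|i L' A' p' _ IH]; first exact: even_quartic1.
exact: even_quarticM.
Qed.

Lemma even_quartic_one_subX2 k :
  even_quartic ((1 - 'X^2) ^+ k) (- (2%:R * k%:R)) (- (12%:R * k%:R)).
Proof.
elim: k => [|k IH]; first by rewrite !mulr0 oppr0; apply: even_quartic1.
have kE c : - (c * k.+1%:R) = - c + - (c * k%:R) :> int by rewrite -natr1; ring.
rewrite exprS !kE.
apply: even_quarticM => //; exists (-1), 0, 0.
by split; [rewrite polyC0 polyCN polyC1| |]; ring.
Qed.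

Lemma even_quartic_coef4 p A L :
  even_quartic p A L -> 24%:R * p`_4 = L + 3%:R * A ^+ 2.
Proof.
move=> [a [b [R [-> -> ->]]]].
rewrite !coefD !coefCM coefXnM !coefXn coef1 /=; ring.
Qed.

(** Here [a] and [b] are the binomials of [m] over 2 and 4. Pascal's rule mixes parities, so the
    induction also carries [d], the binomial of [m] over 3. *)
Lemma even_quartic_pow_parts m :
  even_quartic (pow_parts m).1 (m%:R ^+ 2 - m%:R)
    (- (2%:R * (m%:R ^+ 4 - 4%:R * m%:R ^+ 2 + 3%:R * m%:R))).
Proof.
have [a [b [d [R [R' [E _ aE bE _]]]]]] : exists a b d R R',
  [/\ (pow_parts m).1 = 1 + a%:P * 'X^2 + b%:P * 'X^4 + 'X^6 * R,
      (pow_parts m).2 = m%:R%:P * 'X + d%:P * 'X^3 + 'X^5 * R',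
      2%:R * a = m%:R * (m%:R - 1),
      24%:R * b = m%:R * (m%:R - 1) * (m%:R - 2%:R) * (m%:R - 3%:R) &
      6%:R * d = m%:R * (m%:R - 1) * (m%:R - 2%:R) :> int].
  elim: m => [|m [a [b [d [R [R' [Ee Eo aE bE dE]]]]]]].
    by exists 0, 0, 0, 0, 0; split; rewrite /= ?polyC0; ring.
  exists (a + m%:R), (b + d), (d + a), (R + R'), (R' + b%:P + 'X^2 * R).
  have m1 : m.+1%:R = m%:R + 1 :> int by rewrite -natr1.
  rewrite m1 /=; case: (pow_parts m) Ee Eo => e o /= -> ->.
  split; first by rewrite !polyCD; ring.
  - by rewrite !polyCD polyC1; ring.
  - by rewrite mulrDr aE; ring.
  - have -> : 24%:R * (b + d) = 24%:R * b + 4%:R * (6%:R * d) by ring.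
    by rewrite bE dE; ring.
  have -> : 6%:R * (d + a) = 6%:R * d + 3%:R * (2%:R * a) by ring.
  by rewrite dE aE; ring.
exists a, b, R; split => //; first by rewrite aE; ring.
have -> : 24%:R * b - 12%:R * a ^+ 2 = 24%:R * b - 3%:R * (2%:R * a) ^+ 2 by ring.
by rewrite bE aE; ring.
Qed.

Lemma dvdX_pow_parts2 m : exists R, (pow_parts m).2 = 'X * R.
Proof.
elim: m => [|m [R]] /=; first by exists 0; rewrite mulr0.
by case: (pow_parts m) => e o /= ->; exists (R + e); ring.
Qed.

Lemma prod_pow_parts2 (g : 'I_5 -> nat) :
  exists R, \prod_i (pow_parts (g i)).2 = 'X^5 * R.
Proof.
have [R0 E0] := dvdX_pow_parts2 (g ord0).
rewrite !big_ord_recl big_ord0.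
have [R1 E1] := dvdX_pow_parts2 (g (lift ord0 ord0)).
have [R2 E2] := dvdX_pow_parts2 (g (lift ord0 (lift ord0 ord0))).
have [R3 E3] := dvdX_pow_parts2 (g (lift ord0 (lift ord0 (lift ord0 ord0)))).
have [R4 E4] := dvdX_pow_parts2 (g (lift ord0 (lift ord0 (lift ord0 (lift ord0 ord0))))).
by rewrite E0 E1 E2 E3 E4; exists (R0 * R1 * R2 * R3 * R4); ring.
Qed.

(** The five odd parts are each divisible by [x], so their product starts at [x^5]. *)
Lemma coef4_base_poly c g (q : {poly int}) :
  (q * base_poly c g)`_4 = (q * \prod_i (pow_parts (g i)).1)`_4.
Proof.
rewrite /base_poly mulrDr coefD -scalerAr coefZ.
by have [R ->] := prod_pow_parts2 g; rewrite mulrCA coefXnM /= mulr0 addr0.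
Qed.

(** With [G = T - F] and [2K = 5T - 2u], the fourth powers and the square of the sum of the [F_i^2]
    cancel. What remains involves [F] only through its sums of squares and cubes. *)
Lemma coef4_base_poly_diff (T u K : nat) (F G : 'I_5 -> nat) :
  (forall i, G i + F i = T)%N -> (\sum_i F i = u)%N -> (2 * K + 2 * u = 5 * T)%N ->
  let t : int := T%:R in let w : int := u%:R in
  24%:R * ((base_poly 1 G)`_4 - ((1 - 'X^2) ^+ K * base_poly (-1) F)`_4) =
  2%:R * t * (4%:R * (\sum_i (F i)%:R ^+ 3) +
              (9%:R * t - 6%:R * w) * (\sum_i (F i)%:R ^+ 2)) +
  (8%:R * t ^+ 3 * w - 10%:R * t ^+ 4 + 8%:R * (5%:R * t ^+ 2 - 2%:R * t * w) +
   3%:R * (5%:R * t ^+ 2 - 2%:R * t * w) *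
     (5%:R * t ^+ 2 - 2%:R * t * w - 10%:R * t + 2%:R * w)).
Proof.
move=> GF sumF KE t w.
rewrite mulrBr -[base_poly 1 G]mul1r !coef4_base_poly mul1r.
rewrite (even_quartic_coef4 (even_quartic_prod (fun i => even_quartic_pow_parts (G i)))).
rewrite (even_quartic_coef4 (even_quarticM (even_quartic_one_subX2 K)
          (even_quartic_prod (fun i => even_quartic_pow_parts (F i))))).
have GE i : (G i)%:R = t - (F i)%:R :> int by rewrite /t -(GF i) natrD addrK.
have K2 : 2%:R * K%:R = 5%:R * t - 2%:R * w :> int.
  by rewrite /t /w -!natrM -KE natrD addrK.
have K12 : 12%:R * K%:R = 6%:R * (5%:R * t - 2%:R * w) :> int by rewrite -K2; ring.
have wE : w = \sum_i (F i)%:R by rewrite /w -sumF natr_sum.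
rewrite K12 K2 wE !big_ord_recl !big_ord0 !GE; ring.
Qed.

(** * Balanced frequency vectors *)

(** Summing the pairwise bounds over the other four indices gives [5 F_i - 4 <= u <= 5 F_i + 4]. *)
Lemma balanced_divn (F : 'I_5 -> nat) u :
  (forall i j, F i <= (F j).+1)%N -> (\sum_i F i = u)%N ->
  forall i, (F i == u %/ 5)%N || (F i == (u %/ 5).+1)%N.
Proof.
move=> bal sumF i.
have sum_ne n : (\sum_(j < 5 | j != i) n = 4 * n)%N.
  by rewrite sum_nat_const cardC1 card_ord.
have le1 : (u <= F i + 4 * (F i).+1)%N.
  by rewrite -sumF (bigD1 i) //= leq_add2l -sum_ne; apply: leq_sum.
have le2 : (F i + 4 * F i <= u + 4 * 1)%N.
  rewrite -sumF (bigD1 i) //= -addnA leq_add2l -!sum_ne.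
  by rewrite -big_split /=; apply: leq_sum => j _; rewrite addn1.
lia.
Qed.

(** The sum forces exactly [u %% 5] entries to be the larger value, so a symmetric product depends
    only on [u]. *)
Lemma prod_balanced (g : nat -> {poly int}) (F : 'I_5 -> nat) u :
  (forall i, (F i == u %/ 5)%N || (F i == (u %/ 5).+1)%N) -> (\sum_i F i = u)%N ->
  \prod_i g (F i) = g (u %/ 5)%N ^+ (5 - u %% 5) * g (u %/ 5).+1%N ^+ (u %% 5)%N.
Proof.
set q := (u %/ 5)%N => Fq sumF; pose P := [set i | F i == q.+1].
have cP : #|P| = (u %% 5)%N.
  have : (\sum_(i < 5) (q + (i \in P)) = u)%N.
    rewrite -sumF; apply: eq_bigr => i _; rewrite inE.
    case/orP: (Fq i) => /eqP ->; last by rewrite eqxx addn1.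
    by rewrite (ltn_eqF (ltnSn q)) addn0.
  rewrite big_split /= sum_nat_const card_ord -big_mkcond sum1_card => sumE.
  by apply/(@addnI (5 * q)%N); rewrite sumE mulnC -divn_eq.
have cPC : #|~: P| = (5 - u %% 5)%N by rewrite cardsCs setCK card_ord cP.
rewrite (bigID (mem P)) /= mulrC; congr (_ * _).
  rewrite -cPC -prodr_const; apply: eq_big => i; rewrite !inE //.
  by case/orP: (Fq i) => /eqP ->; rewrite ?eqxx.
by rewrite -cP -prodr_const; apply: eq_bigr => i; rewrite inE => /eqP ->.
Qed.

(* With [q = u %/ 5], the function [4 z^3 + (9T - 6u) z^2] differs from
   [(z - q) (z - q - 1) (4 z + kappa)] by an affine function of [z]; the latter
   is nonnegative on the naturals because [kappa > 0], and vanishes exactly at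
   [q] and [q + 1]. The bound [8 u <= 15 T] ensures [kappa > 0]. *)
Lemma balanced_cubic_lt (t u : nat) (c : int) (F F' : 'I_5 -> nat) :
  c = 9%:R * (2 ^ t)%:R - 6%:R * u%:R ->
  (8 * u <= 15 * 2 ^ t)%N -> (\sum_i F i = u)%N -> (\sum_i F' i = u)%N ->
  (forall i, (F i == u %/ 5)%N || (F i == (u %/ 5).+1)%N) ->
  ~~ [forall i, (F' i == u %/ 5)%N || (F' i == (u %/ 5).+1)%N] ->
  4%:R * (\sum_i (F i)%:R ^+ 3) + c * (\sum_i (F i)%:R ^+ 2) <
  4%:R * (\sum_i (F' i)%:R ^+ 3) + c * (\sum_i (F' i)%:R ^+ 2).
Proof.
move=> cE le_u sumF sumF' Fq F'q.
pose q : int := (u %/ 5)%N%:R; pose kappa : int := 8%:R * q + 4%:R + c.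
have kappa_gt0 : 0 < kappa.
  (* The estimate [q >= (u - 4) / 5] gives [kappa >= (3/4) 2^t - 12/5], positive from [2 ^ t = 4]
     on; for 1 and 2 the exact quotient is used. *)
  have : [\/ 2 ^ t = 1, 2 ^ t = 2 | 4 <= 2 ^ t]%N.
    case: t {le_u cE} => [|[|t]]; [exact: Or31|exact: Or32|apply: Or33].
    by rewrite (leq_pexp2l (m := 2) (n1 := 2)).
  rewrite /kappa cE /q !natz; move: (2 ^ t)%N le_u => T le_u; case; lia.
pose h (z : int) := (z - q) * (z - q - 1) * (4%:R * z + kappa).
have hE (G : 'I_5 -> nat) : (\sum_i G i = u)%N ->
  4%:R * (\sum_i (G i)%:R ^+ 3) + c * (\sum_i (G i)%:R ^+ 2) =
  \sum_i h (G i)%:R + (- (q * (q + 1) * 4%:R) + kappa * (2%:R * q + 1)) * u%:R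
   - 5%:R * (q * (q + 1) * kappa).
  move=> sumG; have -> : c = kappa - 4%:R * (2%:R * q + 1) by rewrite /kappa; ring.
  by rewrite -sumG natr_sum /h !big_ord_recl !big_ord0; ring.
rewrite !hE // ltrD2r ltrD2r.
have h_ge0 (z : nat) : 0 <= h z%:R.
  rewrite /h; apply: mulr_ge0; last by apply: addr_ge0; rewrite ?mulr_ge0 // ltW.
  rewrite /q; case: (leqP z (u %/ 5)) => lez; nia.
rewrite big1 => [|i _]; last first.
  rewrite /h /q; case/orP: (Fq i) => /eqP ->; first by rewrite subrr !mul0r.
  by rewrite -natr1 addrAC subrr add0r subrr mulr0 mul0r.
have [i F'i] := forallPn F'q.
rewrite (bigD1 i) //= ltr_wpDr ?sumr_ge0 //.
rewrite /h pmulr_lgt0; last by apply: ltr_wpDl => //; rewrite mulr_ge0.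
move: F'i; rewrite negb_or /q => /andP[/eqP ne1 /eqP ne2].
by case: (ltnP (F' i) (u %/ 5)) => lez; nia.
Qed.

(** * Lexicographic comparison *)

Definition first_diff_lt d (L : orderType d) (m n : nat) (a b : nat -> L) : Prop :=
  exists2 k, (m <= k < n)%N &
    (a k < b k)%O /\ (forall i, (m <= i < k)%N -> a i = b i).

Lemma lexi_index_iotaP d (L : orderType d) m n (a b : nat -> L) :
  ([seq a i | i <- index_iota m n] <= [seq b i | i <- index_iota m n] :> seqlexi L)%O
  <-> (forall i, (m <= i < n)%N -> a i = b i) \/ first_diff_lt m n a b.
Proof.
rewrite /index_iota /first_diff_lt; move Dr: (n - m)%N => r.
elim: r m Dr => [|r IH] m Dr /=.
  by split=> // _; left=> i; lia.
have ltmn : (m < n)%N by lia.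
rewrite lexi_cons; split.
  case: (comparableP (a m) (b m)) (le_total (a m) (b m)) => //= [ltab _ _|eqab _].
    by right; exists m; [lia|split=> // i; lia].
  case/IH=> [|eqi|[k km [ltk eqi]]]; first by lia.
    by left=> i im; case: (eqVneq m i) => [<-|nemi] //; apply: eqi; lia.
  right; exists k; first by lia.
  by split=> // i im; case: (eqVneq m i) => [<-|nemi] //; apply: eqi; lia.
case=> [eqi|[k km [ltk eqi]]].
  rewrite eqi ?lexx; last by lia.
  by apply/IH; [lia|left=> i im; apply: eqi; lia].
case: (eqVneq m k) ltk => [<- ltk|nemk ltk].
  by rewrite (ltW ltk) leNgt ltk.
rewrite eqi ?lexx; last by lia.
apply/IH; [lia|right; exists k; first by lia].
by split=> // i im; apply: eqi; lia.
Qed.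

(** A factor with constant term 1 preserves the first nonzero coefficient and its position. *)
Lemma coefM_low (p q : {poly int}) k : p`_0 = 1 ->
  (forall i, (i < k)%N -> q`_i = 0) -> forall i, (i <= k)%N -> (p * q)`_i = q`_i.
Proof.
move=> p0 q0 i ik; rewrite coefM big_ord_recl p0 mul1r subn0 big1 ?addr0 // => j _.
by rewrite q0 ?mulr0 // lift0; have := ltn_ord j; lia.
Qed.

Lemma coef0_one_subX2_exp K : ((1 - 'X^2) ^+ K : {poly int})`_0 = 1.
Proof.
rewrite -horner_coef0 horner_exp; have -> : (1 - 'X^2).[0] = 1 :> int by rewrite !hornerE.
by rewrite expr1n.
Qed.

Lemma num_words_projection N m (Y : 'M['F_2]_(N, m)) (S : {set 'I_m}) i :
  num_words (projection Y S) i = num_subwords Y S i.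
Proof.
rewrite num_words_colsub; last exact: enum_val_inj.
congr num_subwords; apply/setP => j; apply/imsetP/idP => [[k _ ->]|Sj].
  exact: enum_valP.
by exists (enum_rank_in Sj j); rewrite ?enum_rankK_in.
Qed.

(** The first difference falls in the range of the pattern: both counts are 1 at length 0 and 0
    beyond [#|S|]. *)
Lemma first_diff_num_subwords t (S S' : {set 'I_(dbl_dim t 5)}) :
  #|S'| = #|S| ->
  (exists2 k, (num_subwords (X t) S k < num_subwords (X t) S' k)%N &
     forall i, (i < k)%N -> num_subwords (X t) S i = num_subwords (X t) S' i) ->
  first_diff_lt 1 #|S|.+1 (num_subwords (X t) S) (num_subwords (X t) S').
Proof.
move=> cS' [k ltk eqi]; exists k; last by split=> // i ik; apply: eqi; lia.
apply/andP; split; first by rewrite lt0n; apply: contraTneq ltk => ->; rewrite !num_subwords0.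
rewrite ltnS -cS' leqNgt; apply: contraTN ltk => ltSk.
by rewrite [X in (_ < X)%N]num_subwords_gt.
Qed.

(** * From the order on complements to the order on designs *)

Lemma coef4_word_poly_setC t (S : {set 'I_(dbl_dim t 5)}) K :
  (#|~: S| <= (5 * 2 ^ t)./2)%N -> K = ((5 * 2 ^ t)./2 - #|~: S|)%N ->
  (2 ^ t)%:R * (num_subwords (X t) S 4)%:R =
  (2 ^ t)%:R * ((num_subwords (X t) (~: S) 4)%:R + ((1 - 'X^2) ^+ K : {poly int})`_4)
  + ((base_poly 1 (freq S))`_4 -
     ((1 - 'X^2) ^+ K * base_poly (-1) (freq (~: S)))`_4) :> int.
Proof.
move=> le_u KE; have /(congr1 (fun p : {poly int} => p`_4)) := word_poly_setC le_u.
rewrite -KE coefZ coef_word_poly expr1n mul1r coefD => ->.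
rewrite mulrBr -scalerAr coefB coefZ -!addrA [- _ + _]addrC; congr (_ * _ + _).
rewrite coefM !big_ord_recl big_ord0 !coef_word_poly /=.
rewrite !(num_subwords_X_small _ (i := 3)) // (num_subwords_X_small _ (i := 2)) //.
rewrite (num_subwords_X_small _ (i := 1)) // num_subwords0 coef0_one_subX2_exp.
rewrite !mulr0 !add0r !addr0 !mulr1 mul1r.
by rewrite subn0 (exprM (-1) 2 2) sqrrN !expr1n mul1r.
Qed.

Lemma eq_base_poly c g g' : g =1 g' -> base_poly c g = base_poly c g'.
Proof.
move=> gg'; rewrite /base_poly.
by congr (_ + _ *: _); apply: eq_bigr => i _; rewrite gg'.
Qed.

(** Applied with [h] the identity for the complements and [h] the subtraction from [2 ^ t] for the
    designs themselves. *)
Lemma base_poly_balanced c (h : nat -> nat) (F F' : 'I_5 -> nat) u :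
  (forall i, (F i == u %/ 5)%N || (F i == (u %/ 5).+1)%N) -> (\sum_i F i = u)%N ->
  (forall i, (F' i == u %/ 5)%N || (F' i == (u %/ 5).+1)%N) -> (\sum_i F' i = u)%N ->
  base_poly c (h \o F) = base_poly c (h \o F').
Proof.
move=> Fq sumF F'q sumF'; rewrite /base_poly /=; congr (_ + _ *: _).
  by rewrite !(@prod_balanced (fun z => (pow_parts (h z)).1) _ u).
by rewrite !(@prod_balanced (fun z => (pow_parts (h z)).2) _ u).
Qed.

Lemma num_subwords_setC_lexi t (S S' : {set 'I_(dbl_dim t 5)}) :
  #|S'| = #|S| -> (8 * #|~: S| <= 15 * 2 ^ t)%N ->
  (forall i j, freq (~: S) i <= (freq (~: S) j).+1)%N ->
  let a i : int := (-1) ^+ i * (num_subwords (X t) (~: S) i)%:R in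
  let a' i : int := (-1) ^+ i * (num_subwords (X t) (~: S') i)%:R in
  (forall i, a i = a' i) \/
    (exists k, [/\ (4 <= k)%N, a k < a' k & forall i, (i < k)%N -> a i = a' i]) ->
  (forall i, num_subwords (X t) S i = num_subwords (X t) S' i) \/
  (exists2 k, (num_subwords (X t) S k < num_subwords (X t) S' k)%N &
     forall i, (i < k)%N -> num_subwords (X t) S i = num_subwords (X t) S' i).
Proof.
move=> cS' le_u bal a a' alt.
have cC : #|~: S'| = #|~: S| by rewrite -!setTD !cardsDS ?subsetT // cS'.
pose F := freq (~: S); pose F' := freq (~: S'); pose u := #|~: S|.
have sumF : (\sum_i F i = u)%N by apply: sum_freq.
have sumF' : (\sum_i F' i = u)%N by rewrite sum_freq.
have Fq := balanced_divn bal sumF.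
have le_half : (u <= (5 * 2 ^ t)./2)%N by rewrite /u; lia.
have le_half' : (#|~: S'| <= (5 * 2 ^ t)./2)%N by rewrite cC.
have T_gt0 : 0 < (2 ^ t)%:R :> int by rewrite ltr0n expn_gt0.
have T_neq0 := lt0r_neq0 T_gt0.
set K := ((5 * 2 ^ t)./2 - u)%N.
have KE' : K = ((5 * 2 ^ t)./2 - #|~: S'|)%N by rewrite cC.
(* An unbalanced competitor comes first: the complement has [A_4] at least as large and the base
   contribution is strictly larger, so it loses at length 4. *)
have [/forallP F'q|F'q] :=
    boolP [forall i, (F' i == u %/ 5)%N || (F' i == (u %/ 5).+1)%N]; last first.
  have le4 : (num_subwords (X t) (~: S) 4)%:R <= (num_subwords (X t) (~: S') 4)%:R :> int.
    have aE i : i = 4%N -> a i = (num_subwords (X t) (~: S) i)%:R.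
      by move=> ->; rewrite /a (exprM (-1) 2 2) sqrrN !expr1n mul1r.
    have aE' i : i = 4%N -> a' i = (num_subwords (X t) (~: S') i)%:R.
      by move=> ->; rewrite /a' (exprM (-1) 2 2) sqrrN !expr1n mul1r.
    rewrite -aE // -aE' //; case: alt => [->//|[k [k4 ltk eqi]]].
    move: k4; rewrite leq_eqVlt => /orP[/eqP->|/eqi->//]; exact: ltW.
  right; exists 4%N => [|i i4]; last first.
    case: i i4 => [|i] i4; first by rewrite !num_subwords0.
    by rewrite !num_subwords_X_small.
  (* For [t = 0], [u <= 1] and every frequency is 0 or 1, hence balanced. For [t > 0], [5 * 2 ^ t]
     is even and the halving in [K] is exact. *)
  have t_gt0 : (0 < t)%N.
    rewrite lt0n; apply: contraNneq F'q => t0; apply/forallP => i.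
    have T1 : (2 ^ t = 1)%N by rewrite t0.
    by have := freq_setC S' i; rewrite -/(F' i); move: le_u; rewrite -/u T1; lia.
  have K2 : (2 * K + 2 * u = 5 * 2 ^ t)%N.
    by move: le_half; rewrite /K -(prednK t_gt0) expnS; lia.
  have := balanced_cubic_lt erefl le_u sumF sumF' Fq F'q.
  set c := _ - _ => ltF.
  have E := coef4_word_poly_setC le_half (erefl K).
  have E' := coef4_word_poly_setC le_half' KE'.
  have D := coef4_base_poly_diff (freq_setC S) sumF K2.
  have D' := coef4_base_poly_diff (freq_setC S') sumF' K2.
  rewrite -(ltr_nat int) -(ltr_pM2l T_gt0) E E'.
  apply: ler_ltD; first by rewrite ler_pM2l // lerD2r.
  rewrite -(ltr_pM2l (_ : 0 < 24%:R :> int)) // D D' ltrD2r -!mulrA ltr_pM2l //.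
  by rewrite ltr_pM2l.
have freqE (A : {set 'I_(dbl_dim t 5)}) : freq A =1 (subn (2 ^ t) \o freq (~: A)).
  by move=> i; rewrite /= -(freq_setC A i) addnK.
(* For a balanced competitor the base terms of [S] and [S'] agree, so the two enumerators differ by
   [(1 - x^2)^K * Q]. *)
pose Q := word_poly (-1) (X t) (~: S) - word_poly (-1) (X t) (~: S').
have QE i : Q`_i = a i - a' i by rewrite coefB !coef_word_poly.
have diffE i : (2 ^ t)%:R * ((num_subwords (X t) S i)%:R - (num_subwords (X t) S' i)%:R) =
    (2 ^ t)%:R * ((1 - 'X^2) ^+ K * Q)`_i :> int.
  rewrite -coefZ scalerAr /Q scalerBr.
  have := word_poly_setC le_half; have := word_poly_setC le_half'; rewrite -KE' -/K.
  rewrite (eq_base_poly _ (freqE S)) (eq_base_poly _ (freqE S')) -/F -/F'.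
  rewrite (base_poly_balanced 1 (subn (2 ^ t)) Fq sumF F'q sumF').
  rewrite [base_poly (-1) F](base_poly_balanced (-1) id Fq sumF F'q sumF').
  rewrite -[id \o F']/F'.
  move: (base_poly 1 _) (base_poly (-1) _) => b1 b2 E' E; transitivity
      (((2 ^ t)%:R *: word_poly 1 (X t) S - (2 ^ t)%:R *: word_poly 1 (X t) S')`_i).
    by rewrite -scalerBr coefZ coefB !coef_word_poly !expr1n !mul1r.
  by rewrite E E' opprD addrACA subrr addr0 -mulrBr opprB addrA subrK.
have diffE' i : (num_subwords (X t) S i)%:R - (num_subwords (X t) S' i)%:R =
    ((1 - 'X^2) ^+ K * Q)`_i by apply: (mulfI T_neq0).
have eq_low k : (forall i, (i < k)%N -> a i = a' i) ->
    forall i, (i <= k)%N ->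
    (num_subwords (X t) S i)%:R - (num_subwords (X t) S' i)%:R = a i - a' i.
  move=> eqi i ik; rewrite diffE' -QE; apply: (coefM_low _ _ ik).
    exact: coef0_one_subX2_exp.
  by move=> j jk; rewrite QE eqi ?subrr.
case: alt => [eqa|[k [k4 ltk eqi]]].
  left=> i; apply/eqP; rewrite -(eqr_nat int) -subr_eq0.
  by rewrite (eq_low i) // eqa subrr.
right; exists k; first by rewrite -(ltr_nat int) -subr_lt0 (eq_low k) // subr_lt0.
move=> i ik; apply/eqP; rewrite -(eqr_nat int) -subr_eq0.
by rewrite (eq_low k) ?(ltnW ik) // eqi // subrr.
Qed.

(** * From column sets back to matrices *)

Local Open Scope nat_scope.

(* D = projection (X t) S and its complement is projection (X t) (~: S). *)
Theorem theorem2 (t N n : nat) (S : {set 'I_(dbl_dim t 5)})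
    (hN : N = 16 * 2 ^ t)
    (hn : n = #|S|)
    (hlow : 25 * N <= 128 * n)
    (hupp : 16 * n <= 5 * N)
    (hmin : sequentially_minimizes
              (@is_projection _ _ (X t) #|~: S|)
              (@alternating_pattern _ _)
              (projection (X t) (~: S)))
    (hbal : forall i j : 'I_5, i < j ->
              (`|(freq (~: S) i)%:Z - (freq (~: S) j)%:Z| <= 1)%R) :
  minimum_aberration (@is_projection _ _ (X t) #|S|) (projection (X t) S).
Proof.
split=> [|D [f f_inj ->]]; first exact: projectionP.
pose S' := [set f k | k : 'I_#|S|].
have cS' : #|S'| = #|S| by rewrite card_imset // card_ord.
have cC : #|~: S| = #|~: S'| by rewrite -!setTD !cardsDS ?subsetT // cS'.
(* Substituting [N = 16 * 2 ^ t] and [n = 5 * 2 ^ t - u] into [25 N <= 128 n]. *)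
have le_u : 8 * #|~: S| <= 15 * 2 ^ t.
  by have := cardsC S; have := dbl_dimE t 5; rewrite card_ord -hn; lia.
have bal i j : freq (~: S) i <= (freq (~: S) j).+1.
  case: (ltngtP i j) => [/hbal|/hbal|/val_inj->]; [lia|lia|exact: leqnSn].
(* The complement of the competitor, listed over ['I_#|~: S|] so that [hmin] applies to it. *)
pose g (k : 'I_#|~: S|) : 'I_(dbl_dim t 5) := enum_val (cast_ord cC k).
have g_inj : injective g by move=> k l /enum_val_inj/cast_ord_inj.
have gE : [set g k | k : 'I_#|~: S|] = ~: S'.
  apply/eqP; rewrite eqEcard card_imset // card_ord -cC leqnn andbT.
  by apply/subsetP => _ /imsetP[k _ ->]; apply: enum_valP.
have [_ /(_ (colsub g (X t)))] := hmin.
move=> /(_ (ex_intro2 _ _ g g_inj erefl)) /lexi_index_iotaP alt.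
suff : (forall i, num_subwords (X t) S i = num_subwords (X t) S' i) \/
  (exists2 k, num_subwords (X t) S k < num_subwords (X t) S' k &
     forall i, i < k -> num_subwords (X t) S i = num_subwords (X t) S' i).
  move=> cmp; apply/lexi_index_iotaP.
  case: cmp => [eqi|/(first_diff_num_subwords cS')[k km [ltk eqi]]]; [left|right].
    by move=> i _; rewrite num_words_projection num_words_colsub // eqi.
  exists k => //; rewrite !num_words_projection !num_words_colsub //; split=> // i im.
  by rewrite num_words_projection num_words_colsub // eqi.
apply: num_subwords_setC_lexi => //.
have altE i : ((-1) ^+ i * (num_words (projection (X t) (~: S)) i)%:Z =
    (-1) ^+ i * (num_subwords (X t) (~: S) i)%:R)%R.
  by rewrite num_words_projection natz.
have altE' i : ((-1) ^+ i * (num_words (colsub g (X t)) i)%:Z =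
    (-1) ^+ i * (num_subwords (X t) (~: S') i)%:R)%R.
  by rewrite num_words_colsub // gE natz.
(* The alternating patterns only compare lengths from 4 to [u]. Below 4 the counts agree by
   resolution IV, and above [u] both are 0. *)
have eq_small i : i < 4 ->
    num_subwords (X t) (~: S) i = num_subwords (X t) (~: S') i.
  by case: i => [|i] i4; rewrite ?num_subwords0 ?num_subwords_X_small.
case: alt => [eqi|[k /andP[k4 ku] [ltk eqi]]].
  left=> i; case: (ltnP i 4) => [/eq_small->//|i4].
  case: (ltnP #|~: S| i) => iu; last by rewrite -altE -altE'; apply: eqi; lia.
  by rewrite !num_subwords_gt // -cC.
right; exists k; rewrite -altE -altE'; split=> // i ik.
case: (ltnP i 4) => [/eq_small->//|i4].
by rewrite -altE -altE'; apply: eqi; lia.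
Qed.
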